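(* For a partition $\lambda$ define \[ \widetilde{\mathrm{wt}}_{\mathbb{Z}_3}(\lambda)=\left|\{\square\in\lambda : a(\square)+1\equiv l(\square) \pmod 3\}\right|, \] and define nonnegative integers $\tilde b_{k,n}$ by \[ \sum_{\lambda}q^{|\lambda|}t^{\widetilde{\mathrm{wt}}_{\mathbb{Z}_3}(\lambda)}=\sum_{k,n\ge 0}\tilde b_{k,n}t^kq^n, \] the sum running over all partitions $\lambda$ (including the empty one); i.e. $\tilde b_{k,n}$ is the number of partitions $\lambda$ of $n$ with $\widetilde{\mathrm{wt}}_{\mathbb{Z}_3}(\lambda)=k$. Then for all $n\ge 2$, \[ \tilde b_{n,2n}=1,\qquad \tilde b_{n,2n+1}=3, \] and $\tilde b_{k,n}=0$ whenever $k>n/2$.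
   Context: Partitions are represented by southwest-justified Young diagrams (French convention): a partition $\lambda=(\lambda_1\ge\lambda_2\ge\cdots\ge\lambda_\ell>0)$ has $\lambda_r$ boxes in its $r$-th row from the bottom. $|\lambda|$ is the number of boxes. For a box $\square\in\lambda$, the arm $a(\square)$ is the number of boxes of $\lambda$ strictly above $\square$ in its column, and the leg $l(\square)$ is the number of boxes of $\lambda$ strictly to the right of $\square$ in its row. *)

(* Defs.v *)
From mathcomp Require Import all_boot.

Set Implicit Arguments.
Unset Strict Implicit.
Unset Printing Implicit Defensive.

Definition is_partition (la : seq nat) : bool := sorted geq la && (0 \notin la).

Definition is_partition_of (n : nat) (la : seq nat) : bool :=
  is_partition la && (sumn la == n).

(* A box is a pair (r, c), both counted from 0: r is the height of its row    *)
(* above the bottom row, c the distance of its column from the left.          *)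
Definition boxes (la : seq nat) : seq (nat * nat) :=
  [seq (r, c) | r <- iota 0 (size la), c <- iota 0 (nth 0 la r)].

Definition arm (la : seq nat) (b : nat * nat) : nat :=
  count (fun b' => (b.1 < b'.1) && (b'.2 == b.2)) (boxes la).

Definition leg (la : seq nat) (b : nat * nat) : nat :=
  count (fun b' => (b'.1 == b.1) && (b.2 < b'.2)) (boxes la).

Definition wtZ3 (la : seq nat) : nat :=
  count (fun b => arm la b + 1 == leg la b %[mod 3]) (boxes la).

(* A partition of n has at most n parts, each at most n; the finite type      *)
(* {bseq n of 'I_n.+1} of sequences with these bounds therefore contains all  *)
(* of them, see [partition_of_bseq].                                          *)
Definition partitions_of (n : nat) : {set {bseq n of 'I_n.+1}} :=
  [set s : {bseq n of 'I_n.+1} | is_partition_of n [seq val i | i <- s]].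

Definition bt (k n : nat) : nat :=
  #|[set s in partitions_of n | wtZ3 [seq val i | i <- s] == k]|.

Lemma partition_of_bseq n (la : seq nat) : is_partition_of n la ->
  exists2 s : {bseq n of 'I_n.+1},
    s \in partitions_of n & [seq val i | i <- s] = la.
Proof.
move=> la_n; move: (la_n) => /andP[/andP[_ la_gt0] /eqP sum_la].
have le_la m : m \in la -> m < n.+1.
  rewrite ltnS -sum_la; elim: {la_n la_gt0 sum_la}la => //= x la IHla.
  rewrite inE => /predU1P[-> | /IHla]; first exact: leq_addr.
  by move/leq_trans; apply; apply: leq_addl.
have size_la : size la <= n.
  rewrite -sum_la; elim: {la_n sum_la le_la}la la_gt0 => //= x la IHla.
  rewrite inE negb_or => /andP[x_gt0 /IHla le_la].
  by rewrite -add1n leq_add // lt0n eq_sym.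
have size_s : size [seq @inord n m | m <- la] <= n by rewrite size_map.
have def_la : [seq val i | i <- Bseq size_s] = la.
  rewrite /= -map_comp -[RHS]map_id; apply/eq_in_map => m /le_la m_n /=.
  exact: inordK.
by exists (Bseq size_s); rewrite // inE def_la.
Qed.

(* Main.v *)
(** Read the boundary of a partition from its top left end as a word in E (a
column begins) and S (a row ends). Boxes are the pairs of an E before an S;
mark each step by the residue modulo 3 of #S - #E after it. A box is counted by
the weight exactly when its E and its S carry the same residue. So it suffices
to remember, for the current position, how many earlier E's fall in each of the
three classes: a state (a, b, c), updated by E : (a, b, c) -> (b + 1, c, a) and
S : (a, b, c) -> (c, a, b), where an S creates a + b + c boxes, c of which are
counted. With a suitable potential F >= 0,
  n = 2 wt + (sum of nonnegative slacks of the steps) + F(final state),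
which gives wt <= n / 2. Words of total slack at most 1 are almost forced: they
are (ES)^i E (ES)^k E (ES)^j, possibly with SSS inserted after the first E or
EEE inserted before the last S. The first kind has n - 2 wt = s (s + 1) / 2 with
s = i - k + j, and each insertion adds 1 to n - 2 wt, so n - 2 wt <= 1 becomes a
condition on k - i - j, under which wt determines (i, k, j) through the squares
surrounding it. *)

Require Import Defs.
From mathcomp Require Import all_boot.
From mathcomp Require Import zify.

Set Implicit Arguments.
Unset Strict Implicit.
Unset Printing Implicit Defensive.

(** * The weight, row by row *)

Lemma boxes_cons x la :
  boxes (x :: la) =
    [seq (0, c) | c <- iota 0 x] ++ [seq (b.1.+1, b.2) | b <- boxes la].
Proof.
rewrite /boxes /= map_allpairs; congr (_ ++ _).
by rewrite -[1]/(1 + 0) iotaDl allpairs_mapl.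
Qed.

Lemma count_col_boxes c la :
  count (fun b => b.2 == c) (boxes la) = count (ltn c) la.
Proof.
elim: la => //= x la IHla; rewrite boxes_cons count_cat !count_map /=.
congr (_ + _); last exact: IHla.
rewrite -[LHS]/(count_mem c (iota 0 x)) count_uniq_mem ?iota_uniq //.
by rewrite mem_iota.
Qed.

Lemma arm_cons0 x la c : arm (x :: la) (0, c) = count (ltn c) la.
Proof.
rewrite /arm boxes_cons count_cat !count_map /= -count_col_boxes.
by rewrite (@eq_count _ _ pred0) ?count_pred0.
Qed.

Lemma leg_cons0 x la c : leg (x :: la) (0, c) = x - c.+1.
Proof.
rewrite /leg boxes_cons count_cat !count_map /=.
rewrite [X in _ + X](@eq_count _ _ pred0) // count_pred0 addn0.
rewrite (@eq_count _ _ (ltn c)) //.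
elim: x => // x IHx; rewrite -[X in iota _ X]addn1 iotaD count_cat IHx /=; lia.
Qed.

Lemma arm_consS x la r c : arm (x :: la) (r.+1, c) = arm la (r, c).
Proof.
rewrite /arm boxes_cons count_cat !count_map /=.
by rewrite (@eq_count _ _ pred0) ?count_pred0.
Qed.

Lemma leg_consS x la r c : leg (x :: la) (r.+1, c) = leg la (r, c).
Proof.
rewrite /leg boxes_cons count_cat !count_map /=.
by rewrite (@eq_count _ _ pred0) ?count_pred0.
Qed.

(** In a new bottom row of length [x], the box in column c has leg x - c - 1, so it is counted when
    c + arm = x + 1 mod 3, that is for [d = 1]. The other offsets are needed because each step
    permutes the classes. *)
Definition col_count (d x : nat) (la : seq nat) : nat :=
  count (fun c => c + count (ltn c) la == x + d %[mod 3]) (iota 0 x).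

Lemma wtZ3_cons x la : wtZ3 (x :: la) = wtZ3 la + col_count 1 x la.
Proof.
rewrite /wtZ3 {1}boxes_cons count_cat !count_map addnC; congr (_ + _).
  by apply: eq_count => -[r c] /=; rewrite arm_consS leg_consS.
apply: eq_in_count => c; rewrite mem_iota /= arm_cons0 leg_cons0; lia.
Qed.

Lemma col_countD3 d x la : col_count (d + 3) x la = col_count d x la.
Proof. by apply: eq_count => c /=; rewrite addnA modnDr. Qed.

(** The new column has height 0 in [la], so it joins the class exactly when [d] is 2 mod 3. *)
Lemma col_countS d x la : all (geq x) la ->
  col_count d x.+1 la = col_count d.+1 x la + (d %% 3 == 2).
Proof.
move=> /allP le_la; rewrite /col_count -[X in iota _ X]addn1 iotaD count_cat /=.
congr (_ + _).
  by apply: eq_count => c /=; rewrite addSnnS.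
rewrite (@eq_in_count _ _ pred0) ?count_pred0; first lia.
by move=> y /le_la /=; rewrite ltnNge => ->.
Qed.

Lemma col_count_cons d x la : col_count d x (x :: la) = col_count d.+2 x la.
Proof. by apply: eq_in_count => c; rewrite mem_iota /= => ->; lia. Qed.

(** * The boundary word and its states *)

Notation state := (nat * nat * nat)%type.

(* [(a, b, c).2] is [c], the number of boxes that an S step would count. *)
Definition stepE (s : state) : state := let: (a, b, c) := s in (b.+1, c, a).
Definition stepS (s : state) : state := let: (a, b, c) := s in (c, a, b).

(** The head of the list is the bottom row, which the boundary word ends last; [x - head 0 la'] E
    steps separate its S from the previous one. *)
Fixpoint st (la : seq nat) : state :=
  if la is x :: la' then stepS (iter (x - head 0 la') stepE (st la'))
  else (0, 0, 0).

Lemma is_partition_cons x la : is_partition (x :: la) ->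
  [/\ is_partition la, 0 < x, head 0 la <= x & all (geq x) la].
Proof.
rewrite /is_partition /= inE negb_or => /andP[px /andP[x0 la0]].
have [sla /= xla] : sorted geq la /\ all (geq x) la.
  by apply/andP; rewrite andbC -path_sortedE //; apply/rev_trans/leq_trans.
split; rewrite ?sla ?la0 ?lt0n 1?eq_sym //.
by case: la {px la0 sla} xla => //= y la /andP[].
Qed.

Definition col_state x la :=
  (col_count 2 x la, col_count 0 x la, col_count 1 x la).

Lemma col_stateD x m la : all (geq x) la ->
  col_state (x + m) la = iter m stepE (col_state x la).
Proof.
move=> le_la; elim: m => [|m IHm]; first by rewrite addn0.
have le_la' : all (geq (x + m)) la.
  by apply: sub_all le_la => y /= /leq_trans; apply; apply: leq_addr.
rewrite iterS -IHm addnS /col_state !col_countS //= !addn0.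
by rewrite -(col_countD3 0) addn1.
Qed.

Lemma col_state_head la : is_partition la -> col_state (head 0 la) la = st la.
Proof.
elim: la => //= x la IHla /is_partition_cons[pla _ le_x le_la].
rewrite -(IHla pla) -col_stateD; last first.
  case: la pla {IHla le_x le_la} => //= y la /is_partition_cons[_ _ _ ->].
  by rewrite leqnn.
rewrite subnKC // /col_state !col_count_cons /=.
by rewrite -[3]/(0 + 3) -[4]/(1 + 3) !col_countD3.
Qed.

Definition row_state x la := iter (x - head 0 la) stepE (st la).

Lemma row_stateE x la : is_partition (x :: la) ->
  col_state x la = row_state x la.
Proof.
move=> /is_partition_cons[pla _ le_x le_la].
rewrite /row_state -(col_state_head pla) -col_stateD ?subnKC //.
case: la pla {le_x le_la} => //= y la /is_partition_cons[_ _ _ ->].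
by rewrite leqnn.
Qed.

Lemma wtZ3_row_state x la : is_partition (x :: la) ->
  wtZ3 (x :: la) = wtZ3 la + (row_state x la).2.
Proof. by move=> px; rewrite wtZ3_cons -row_stateE. Qed.

(** * Potential and slack *)

Definition area (s : state) := let: (a, b, c) := s in a + b + c.

Lemma area_iterE m s : area (iter m stepE s) = area s + m.
Proof.
elim: m => [|m IHm]; first by rewrite addn0.
rewrite iterS addnS -IHm; case: (iter m _ _) => -[a b] c /=; lia.
Qed.

Lemma area_st la : is_partition la -> area (st la) = head 0 la.
Proof.
elim: la => //= x la IHla /is_partition_cons[pla _ le_x _].
transitivity (area (iter (x - head 0 la) stepE (st la))).
  by case: (iter _ _ _) => -[a b] c /=; lia.
by rewrite area_iterE IHla // subnKC.
Qed.

Definition slackE (s : state) := let: (a, b, c) := s in c - (a + b).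
Definition slackS (s : state) :=
  let: (a, b, c) := s in minn b.*2 (a + b - c).

(** Truncated subtraction leaves at most one nonzero term, a triangular number in the excess of one
    class over the other two together. *)
Definition potential (s : state) :=
  let: (a, b, c) := s in
  'C(a - (b + c), 2) + 'C((b - (a + c)).+1, 2) + 'C((c - (a + b)).+1, 2).

Lemma binS2 n : 'C(n.+1, 2) = n + 'C(n, 2).
Proof. by rewrite binS bin1 addnC. Qed.

(** For a and b, the new column changes the excess by one and the shift in the binomial compensates;
    only the term of c drops, by its excess. *)
Lemma potentialE s : potential s = slackE s + potential (stepE s).
Proof.
case: s => -[a b] c; rewrite /potential /slackE /stepE.
have bin_pred n : 'C((n - 1).+1, 2) = 'C(n, 2).
  by case: n => // n; rewrite subn1.
have -> : a - (b.+1 + c) = a - (b + c) - 1 by lia.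
have -> : c - (b.+1 + a) = c - (a + b) - 1 by lia.
have -> : 'C(b.+1 - (c + a), 2) = 'C((b - (a + c)).+1, 2).
  case: (leqP (a + c) b) => le_b; first by congr 'C(_, _); lia.
  by do 2![rewrite bin_small; last lia].
rewrite !bin_pred (binS2 (c - _)); lia.
Qed.

(** The term of a rises by its excess, that of c drops by its excess, that of b is unchanged.
    Subtracting the rise from a + b - c leaves 2b when a dominates, hence the minimum in
    [slackS]. *)
Lemma potentialS s :
  potential s + area s = s.2.*2 + slackS s + potential (stepS s).
Proof.
case: s => -[a b] c; rewrite /potential /slackS /stepS /area /=.
rewrite [c + b]addnC [c + a]addnC (binS2 (c - _)) (binS2 (a - _)).
lia.
Qed.

Fixpoint slack_iterE m s :=
  if m is m'.+1 then slackE s + slack_iterE m' (stepE s) else 0.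

Definition row_slack m s := slack_iterE m s + slackS (iter m stepE s).

Fixpoint slack la :=
  if la is x :: la' then slack la' + row_slack (x - head 0 la') (st la') else 0.

Lemma potential_iterE m s :
  potential s = slack_iterE m s + potential (iter m stepE s).
Proof.
elim: m s => //= m IHm s.
by rewrite potentialE (IHm (stepE s)) -iterSr iterS addnA.
Qed.

(** The step identities telescope, since the area before each S is the length of the row it ends. *)
Lemma sumn_wtZ3 la : is_partition la ->
  sumn la = (wtZ3 la).*2 + slack la + potential (st la).
Proof.
elim: la => // x la IHla px; have [pla _ le_x _] := is_partition_cons px.
rewrite wtZ3_row_state // [sumn _]/= [slack _]/= (IHla pla).
rewrite -[st (x :: la)]/(stepS (row_state x la)).
have := potentialS (row_state x la).
rewrite {2}/row_state area_iterE area_st // subnKC //.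
have := potential_iterE (x - head 0 la) (st la).
rewrite /row_slack -/(row_state x la); lia.
Qed.

Lemma slack_iterED m n s :
  slack_iterE (m + n) s = slack_iterE m s + slack_iterE n (iter m stepE s).
Proof. by elim: m s => //= m IHm s; rewrite IHm addnA -iterSr iterS. Qed.

Lemma row_slackD m n s :
  row_slack (m + n) s = slack_iterE m s + row_slack n (iter m stepE s).
Proof. by rewrite /row_slack slack_iterED -addnA -iterD [n + m]addnC. Qed.

(** The last six E steps raise every class by 2. S then costs at least 2 unless c dominated before
    them, and in that case the cost of these E steps makes up the difference. *)
Lemma row_slack_ge6 m s : 6 <= m -> 1 < row_slack m s.
Proof.
move=> m_ge6; rewrite -(subnK m_ge6) row_slackD; apply: ltn_addl.
case: (iter _ _ s) => -[a b] c; rewrite /row_slack /=; lia.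
Qed.

(* From here further E steps cannot escape, and every S step costs. *)
Definition trap (s : state) :=
  let: (a, b, c) := s in [&& a <= b + c, b < a + c & c < a + b].

Lemma trap_iterE m s : trap s -> trap (iter m stepE s).
Proof.
move=> ts; elim: m => //= m; case: (iter m stepE s) => -[a b] c /=; lia.
Qed.

Lemma trap_slackS s : trap s -> 0 < slackS s.
Proof. case: s => -[a b] c /=; lia. Qed.

Lemma trap_row_slack m s : trap s -> 0 < row_slack m s.
Proof. by move=> /(trap_iterE m)/trap_slackS; rewrite /row_slack; lia. Qed.

(** * Words of slack at most 1 *)

Fixpoint stairs m r := if r is r'.+1 then m + r' :: stairs m r' else [::].

(* The boundary word is (ES)^i E (ES)^k E (ES)^j, up to trailing E's. *)
Definition three_stairs i k j :=
  stairs (i + k).+3 j ++ stairs i.+2 k ++ stairs 1 i.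

Definition tail (t : bool) := if t then [:: 1; 1; 1] else [::].

Definition widen3 la := if la is x :: la' then x + 3 :: la' else [::].

Inductive slack1_shape la : Prop :=
| Slack1_stairs i k j of la = three_stairs i k j & k.+1 = i + j
| Slack1_widen i k j of la = widen3 (three_stairs i k j)
    & k = i + j \/ k = (i + j).+1 & 0 < k.

(** The invariant of the induction over rows, relating a partition, its state and its slack. The
    flag [t] is the unit spent on SSS. [SmallTrap] is terminal, as any further row costs a second
    unit. *)
Inductive small_slack : seq nat -> state -> nat -> Prop :=
| SmallNil : small_slack [::] (0, 0, 0) 0
| Small11 : small_slack [:: 1; 1] (0, 0, 1) 1
| Small111 : small_slack [:: 1; 1; 1] (1, 0, 0) 1
| SmallA (t : bool) i : small_slack (stairs 1 i.+1 ++ tail t) (0, i.+1, 0) t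
| SmallB (t : bool) i k :
    small_slack (three_stairs i k.+1 0 ++ tail t) (i.+1, k.+1, 0) t
| SmallC (t : bool) i k j : i + j < k ->
    small_slack (three_stairs i k j.+1 ++ tail t) (k.+1, j.+1, i.+1) t
| SmallTrap la s : slack1_shape la -> trap s -> small_slack la s 1.

Lemma eq_small_slack la la' s s' l l' :
  small_slack la s l -> la = la' -> s = s' -> l = l' -> small_slack la' s' l'.
Proof. by move=> sml <- <- <-. Qed.

Lemma small_slack_trap la s l :
  slack1_shape la -> trap s -> l = 1 -> small_slack la s l.
Proof. by move=> sh ts ->; apply: SmallTrap. Qed.

Lemma small_slack_cons x la s l :
    small_slack la s l -> head 0 la <= x -> 0 < x ->
    let m := x - head 0 la in
    l + row_slack m s <= 1 ->
  small_slack (x :: la) (stepS (iter m stepE s)) (l + row_slack m s).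
Proof.
move=> sml le_x x_gt0 m le1.
have m_lt6 : m < 6.
  by rewrite ltnNge; apply/negP => /(row_slack_ge6 s); lia.
have def_x : x = m + head 0 la by rewrite /m subnK.
have ->: x :: la = (m + head 0 la) :: la by rewrite -def_x.
have : 0 < m + head 0 la by rewrite -def_x.
move: m m_lt6 le1 {def_x le_x x_gt0} => m.
case: {la s l}sml => [||| t i | t i k | t i k j lt_k | la s sh ts];
  last by move=> _ le1; have := trap_row_slack m ts; lia.
(* With at most five E steps every case is explicit; the goals surviving [lia] are the rows whose
   cost can fit in the remaining slack. *)
all: case: m => [|[|[|[|[|[|m]]]]]] //; rewrite /row_slack /= => _.
all: try lia.
- by move=> *; apply: (eq_small_slack (SmallA false 0)).
- by move=> *; apply: (eq_small_slack (SmallB false 0 0)).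
- move=> *; apply: small_slack_trap => //.
  exact: (@Slack1_stairs _ 0 0 1).
- move=> *; apply: small_slack_trap => //.
  by apply: (@Slack1_widen _ 0 1 0) => //; right.
- by move=> *; apply: (eq_small_slack Small111).
- by move=> *; apply: (eq_small_slack (SmallA true 0)).
- by move=> *; apply: (eq_small_slack (SmallB true 0 0)).
- case: t i => [] [|i] le1; try lia.
  by move=> *; apply: (eq_small_slack Small11).
- move=> *; apply: (eq_small_slack (SmallA t i.+1)) => //; lia.
- move=> *; apply: (eq_small_slack (SmallB t i.+1 0)) => //; last lia.
  by rewrite /three_stairs /=; congr (_ :: _); lia.
- case: t i => [] [|i] le1; try lia.
  move=> *; apply: small_slack_trap => //.
  by apply: (@Slack1_widen _ 1 1 0) => //; left.
- move=> *; apply: (eq_small_slack (SmallB t i k.+1)) => //; last lia.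
  by rewrite /three_stairs /=; congr (_ :: _); lia.
(* The third stair starts for free if [i <= k]; the only other affordable case is i = k + 1, at cost
   1. *)
- move=> le1 _; case: (ltnP i k.+1) => [lt_ik | le_ki].
    have lt_k : i + 0 < k.+1 by lia.
    apply: (eq_small_slack (SmallC t lt_k)) => //; last lia.
    by rewrite /three_stairs /=; congr [:: _, _ & _]; lia.
  case: t le1 => le1; first lia.
  apply: small_slack_trap => /=; try lia.
  apply: (@Slack1_stairs _ i k.+1 1); last lia.
  by rewrite /three_stairs /= cats0; congr [:: _, _ & _]; lia.
(* EEE precedes the S of a row that would be free; the unit is charged to S if i = k + 1 and to an E
   if i = k + 2. *)
- case: t => le1 _; first lia.
  apply: small_slack_trap => /=; try lia.
  apply: (@Slack1_widen _ i k.+2 0) => //; last lia.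
  by rewrite /three_stairs /= cats0; congr [:: _, _ & _]; lia.
- case: t => le1 _; first lia.
  apply: small_slack_trap => /=; try lia.
  apply: (@Slack1_widen _ i k.+1 1) => //; last lia.
  by rewrite /three_stairs /= cats0; congr [:: _, _ & _]; lia.
(* The next row of the third stair is free if i + j + 1 < k; otherwise equality holds and it costs
   1. *)
- move=> le1 _; case: (ltnP (i + j.+1) k) => [lt_k' | le_k].
    apply: (eq_small_slack (SmallC t lt_k')) => //; last lia.
    by rewrite /three_stairs /=; congr [:: _, _ & _]; lia.
  case: t le1 => le1; first lia.
  apply: small_slack_trap => /=; try lia.
  apply: (@Slack1_stairs _ i k j.+2); last lia.
  by rewrite /three_stairs /= cats0; congr [:: _, _ & _]; lia.
- case: t => le1 _; first lia.
  apply: small_slack_trap => /=; try lia.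
  apply: (@Slack1_widen _ i k j.+2) => //; try lia.
  by rewrite /three_stairs /= cats0; congr [:: _, _ & _]; lia.
Qed.

Lemma small_slackP la :
  is_partition la -> slack la <= 1 -> small_slack la (st la) (slack la).
Proof.
elim: la => [|x la IHla] pla le1; first exact: SmallNil.
have [{}pla x_gt0 le_x _] := is_partition_cons pla.
have le1' : slack la <= 1 by apply: leq_trans le1; apply: leq_addr.
exact: small_slack_cons (IHla pla le1') le_x x_gt0 le1.
Qed.

(** * Shapes of size 2 wt and 2 wt + 1 *)

Lemma bin2_eq0 n : 'C(n, 2) = 0 -> n <= 1.
Proof. by move=> C0; rewrite leqNgt -(bin_gt0 n 2) C0. Qed.

Lemma bin2_eq1 n : 'C(n, 2) = 1 -> n = 2.
Proof. by case: n => [|[|[|n]]] //; rewrite !binS2 /=; lia. Qed.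

Lemma potential_eq0 a b c : potential (a, b, c) = 0 ->
  [/\ a <= (b + c).+1, b <= a + c & c <= a + b].
Proof.
rewrite /potential => F0.
have /bin2_eq0 ? : 'C(a - (b + c), 2) = 0 by lia.
have /bin2_eq0 ? : 'C((b - (a + c)).+1, 2) = 0 by lia.
have /bin2_eq0 ? : 'C((c - (a + b)).+1, 2) = 0 by lia.
by split; lia.
Qed.

Lemma potential_eq1 a b c : potential (a, b, c) = 1 ->
  [\/ a = (b + c).+2, b = (a + c).+1 | c = (a + b).+1].
Proof.
rewrite /potential => F1.
have [/bin2_eq1|/bin2_eq1|/bin2_eq1] : [\/ 'C(a - (b + c), 2) = 1,
    'C((b - (a + c)).+1, 2) = 1 | 'C((c - (a + b)).+1, 2) = 1].
- have : ('C(a - (b + c), 2) == 1) || ('C((b - (a + c)).+1, 2) == 1)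
      || ('C((c - (a + b)).+1, 2) == 1) by lia.
  by case/orP => [/orP[]|] /eqP; [constructor 1|constructor 2|constructor 3].
- by constructor 1; lia.
- by constructor 2; lia.
- by constructor 3; lia.
Qed.

(** With s = i - k + j, this is s (s + 1) / 2 = 0, and [off_balanced] is s (s + 1) / 2 = 1. *)
Definition balanced i k j := k = i + j \/ k = (i + j).+1.
Definition off_balanced i k j := k.+1 = i + j \/ k = (i + j).+2.

Lemma slack_potential0 la s l : small_slack la s l -> l = 0 ->
  potential s = 0 -> exists i k j, balanced i k j /\ la = three_stairs i k j.
Proof.
case=> {la s l} [||| t i | t i k | t i k j lt_k | la s _ _] //.
- by move=> _ _; exists 0, 0, 0; split=> //; left.
- by case: t => // _ /potential_eq0[]; lia.
- case: t => // _ /potential_eq0[? ? ?]; exists i, k.+1, 0.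
  by rewrite cats0 /balanced; split=> //; lia.
- case: t => // _ /potential_eq0[? ? ?]; exists i, k, j.+1.
  by rewrite cats0 /balanced; split=> //; lia.
Qed.

Inductive odd_shape la : Prop :=
| OddStairs i k j of off_balanced i k j & la = three_stairs i k j
| OddWiden i k j of balanced i k j & 0 < k & la = widen3 (three_stairs i k j)
| OddTail i k j of balanced i k j & la = three_stairs i k j ++ [:: 1; 1; 1].

(** The unit is either the potential, giving off-balanced stairs, or the slack, spent on SSS or on
    entering a trap. *)
Lemma slack_potential1 la s l : small_slack la s l -> l + potential s = 1 ->
  odd_shape la.
Proof.
case=> {la s l} [||| t i | t i k | t i k j lt_k | la s sh ts] //.
- by move=> _; apply: (@OddTail _ 0 0 0) => //; left.
- case: t => D1.
    have /potential_eq0[] : potential (0, i.+1, 0) = 0 by lia.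
    by lia.
  have /potential_eq1[] : potential (0, i.+1, 0) = 1 by lia.
  + by lia.
  + move=> ?; apply: (@OddStairs _ i.+1 0 0); last by rewrite cats0.
    by rewrite /off_balanced; lia.
  + by lia.
- case: t => D1.
    have /potential_eq0[? ? ?] : potential (i.+1, k.+1, 0) = 0 by lia.
    by apply: (@OddTail _ i k.+1 0) => //; rewrite /balanced; lia.
  have /potential_eq1 F1 : potential (i.+1, k.+1, 0) = 1 by lia.
  apply: (@OddStairs _ i k.+1 0); last by rewrite cats0.
  by rewrite /off_balanced; case: F1; lia.
- case: t => D1.
    have /potential_eq0[? ? ?] : potential (k.+1, j.+1, i.+1) = 0 by lia.
    by apply: (@OddTail _ i k j.+1) => //; rewrite /balanced; lia.
  have /potential_eq1 F1 : potential (k.+1, j.+1, i.+1) = 1 by lia.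
  apply: (@OddStairs _ i k j.+1); last by rewrite cats0.
  by rewrite /off_balanced; case: F1; lia.
- move=> _; case: sh => i k j -> *; last exact: (@OddWiden _ i k j).
  by apply: (@OddStairs _ i k j) => //; left.
Qed.

Lemma even_shapeP la : is_partition la -> sumn la = (wtZ3 la).*2 ->
  exists i k j, balanced i k j /\ la = three_stairs i k j.
Proof.
move=> pla; rewrite sumn_wtZ3 // => D0.
by apply: (slack_potential0 (small_slackP _ _)) => //; lia.
Qed.

Lemma odd_shapeP la : is_partition la -> sumn la = (wtZ3 la).*2.+1 ->
  odd_shape la.
Proof.
move=> pla; rewrite sumn_wtZ3 // => D1.
by apply: (slack_potential1 (small_slackP _ _)) => //; lia.
Qed.

(** * Weights and sizes of the shapes *)

(* The bound [x.+1] rather than [x] also allows [la = [:: 1; 1; 1]] at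
   [x = 0], where [s] is not a state of the word of [la] but [stepE s] is. *)
Definition ready la x s :=
  [/\ is_partition la, head 0 la <= x.+1 & row_state x.+1 la = stepE s].

Lemma row_stateS x la : head 0 la <= x ->
  row_state x.+1 la = stepE (row_state x la).
Proof. by move=> le_x; rewrite /row_state subSn. Qed.

Lemma readyE la x s : ready la x s -> ready la x.+1 (stepE s).
Proof.
by case=> pla le_x def_s; split; [|apply: leqW|rewrite row_stateS ?def_s].
Qed.

Lemma is_partition_consI x la :
  is_partition la -> head 0 la <= x -> 0 < x -> is_partition (x :: la).
Proof.
rewrite /is_partition /= inE negb_or => /andP[sla ->] le_x x_gt0.
rewrite andbT [0 == x]eq_sym -lt0n x_gt0 andbT.
by case: la sla le_x => //= y la -> ->.
Qed.

(** S undoes the rotation by E, so ES only adds one to b; in between, a stands in the counted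
    place. *)
Lemma readyES la x a b c : ready la x (a, b, c) ->
  ready (x.+1 :: la) x.+1 (a, b.+1, c) /\ wtZ3 (x.+1 :: la) = wtZ3 la + a.
Proof.
case=> pla le_x def_s; have px := is_partition_consI pla le_x isT.
split; last by rewrite wtZ3_row_state // def_s.
split=> //; rewrite row_stateS //= /row_state /= subnn /=.
by rewrite -/(row_state x.+1 la) def_s.
Qed.

Lemma ready_stairs la x a b c r : ready la x (a, b, c) ->
  ready (stairs x.+1 r ++ la) (x + r) (a, b + r, c) /\
  wtZ3 (stairs x.+1 r ++ la) = wtZ3 la + r * a.
Proof.
move=> rla; elim: r => [|r [IHr IHw]] /=; first by rewrite !addn0.
by have [rS wS] := readyES IHr; rewrite addSn !addnS wS IHw mulSnr addnA.
Qed.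

(** The three stairs run with a = 0, i + 1 and k + 1, since the E before each later stair rotates b
    into first place and adds one. *)
Definition stairs_wt i k j := k * i.+1 + j * k.+1.

Lemma ready_three_stairs la i k j : ready la 0 (0, 0, 0) ->
  is_partition (three_stairs i k j ++ la) /\
  wtZ3 (three_stairs i k j ++ la) = wtZ3 la + stairs_wt i k j.
Proof.
rewrite /three_stairs -!catA => /(ready_stairs i)[]; rewrite !add0n.
move=> /readyE/= /(ready_stairs k)[rk wk] wi; rewrite !add0n in rk.
have [[pj _ _] wj] := ready_stairs j (readyE rk).
have -> : (i + k).+3 = (i.+1 + k).+2 by [].
by split=> //; rewrite wj wk wi muln0 addn0 addnA.
Qed.

Lemma ready_nil : ready [::] 0 (0, 0, 0).
Proof. by []. Qed.

Lemma ready_111 : ready [:: 1; 1; 1] 0 (0, 0, 0).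
Proof. by []. Qed.

Lemma three_stairsP i k j : is_partition (three_stairs i k j) /\
  wtZ3 (three_stairs i k j) = stairs_wt i k j.
Proof. by have := ready_three_stairs i k j ready_nil; rewrite cats0. Qed.

Lemma three_stairs_111P i k j :
  is_partition (three_stairs i k j ++ [:: 1; 1; 1]) /\
  wtZ3 (three_stairs i k j ++ [:: 1; 1; 1]) = (stairs_wt i k j).+1.
Proof. exact: ready_three_stairs ready_111. Qed.

(** EEE keeps the order of the classes and adds one to each, so the last S counts one more box. *)
Lemma widen3P la : is_partition la -> la != [::] ->
  [/\ is_partition (widen3 la), wtZ3 (widen3 la) = (wtZ3 la).+1
    & sumn (widen3 la) = sumn la + 3].
Proof.
case: la => //= x la px _; have [pla x_gt0 le_x _] := is_partition_cons px.
have px3 : is_partition (x + 3 :: la).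
  by apply: is_partition_consI => //; lia.
split=> //; last by rewrite addnAC.
rewrite !wtZ3_row_state // addn3 !row_stateS //; try lia.
by case: (row_state x la) => -[a b] c /=; rewrite addnS.
Qed.

Lemma sumn_stairs m r : (sumn (stairs m r)).*2 + r = r * (m.*2 + r).
Proof. by elim: r => //= r IHr; lia. Qed.

Lemma sumn_three_stairs i k j :
  (sumn (three_stairs i k j)).*2 =
  i * i.+1 + k * (i.*2 + k + 3) + j * (i.*2 + k.*2 + j + 5).
Proof.
rewrite !sumn_cat.
have := sumn_stairs (i + k).+3 j; have := sumn_stairs i.+2 k.
by have := sumn_stairs 1 i; lia.
Qed.

(** * Weights between consecutive squares *)

(** As [j <= k], respectively [j < k], the integer square root of the weight is [k], and the
    remainder gives [j]. *)
Lemma balanced_wt i k j : balanced i k j ->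
  [\/ stairs_wt i k j = k * k + k + j /\ k = i + j
    | stairs_wt i k j = k * k + j /\ k = (i + j).+1].
Proof. by case=> ->; [left | right]; rewrite /stairs_wt; split=> //; lia. Qed.

(** Here the integer square root of the weight plus one is [k.+1] in the first case and [k.-1] in
    the second. *)
Lemma off_balanced_wt i k j : off_balanced i k j ->
  [\/ (stairs_wt i k j).+1 = k.+1 * k.+1 + j /\ k.+1 = i + j
    | (stairs_wt i k j).+2 + k = k * k + j.+2 /\ k = (i + j).+2].
Proof.
case=> def_k; [left | right]; split=> //; rewrite /stairs_wt;
  last by rewrite def_k; lia.
(* Splitting on [i] solves k + 1 = i + j for a variable, leaving a polynomial identity. *)
case: i def_k => [|i] def_k; last first.
  by have -> : k = i + j; lia.
by have -> : j = k.+1; lia.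
Qed.

Lemma sumn_balanced i k j : balanced i k j ->
  sumn (three_stairs i k j) = (stairs_wt i k j).*2.
Proof.
have := sumn_three_stairs i k j; rewrite /stairs_wt.
by move=> sum_ikj [] def_k; move: sum_ikj; rewrite def_k; lia.
Qed.

Lemma sumn_off_balanced i k j : off_balanced i k j ->
  sumn (three_stairs i k j) = (stairs_wt i k j).*2.+1.
Proof.
have := sumn_three_stairs i k j; rewrite /stairs_wt.
move=> sum_ikj [] def_k; move: sum_ikj; last by rewrite def_k; lia.
case: i def_k => [|i] def_k; first by have -> : j = k.+1; lia.
by have -> : k = i + j; lia.
Qed.

Lemma floor_sqrt n : exists k, k * k <= n < k.+1 * k.+1.
Proof.
elim: n => [|n [k /andP[le_k lt_k]]]; first by exists 0.
case: (ltnP n.+1 (k.+1 * k.+1)) => [lt_n | le_n]; first by exists k; lia.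
by exists k.+1; nia.
Qed.

Lemma floor_sqrt_uniq n k k' : k * k <= n < k.+1 * k.+1 ->
  k' * k' <= n < k'.+1 * k'.+1 -> k = k'.
Proof. by move=> ? ?; case: (ltngtP k k') => // ?; nia. Qed.

Lemma balanced_ex n : exists i k j, balanced i k j /\ stairs_wt i k j = n.
Proof.
have [k /andP[le_k lt_k]] := floor_sqrt n; rewrite /stairs_wt /balanced.
case: (ltnP n (k * k + k)) => [lt_n | le_n].
  have [d def_d] : exists d, d + (n - k * k).+1 = k.
    by exists (k - (n - k * k).+1); lia.
  by exists d, k, (n - k * k); split; [right; lia | nia].
have [d def_d] : exists d, d + (n - k * k - k) = k.
  by exists (k - (n - k * k - k)); lia.
by exists d, k, (n - k * k - k); split; [left; lia | nia].
Qed.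

Lemma balanced_inj i k j i' k' j' : balanced i k j -> balanced i' k' j' ->
  stairs_wt i k j = stairs_wt i' k' j' -> [/\ i = i', k = k' & j = j'].
Proof.
move=> /balanced_wt bal /balanced_wt bal' eq_wt.
have def_k : k = k'.
  by apply: (@floor_sqrt_uniq (stairs_wt i k j));
    case: bal bal' => [] [? ?] [] [? ?]; nia.
by move: bal bal'; rewrite -eq_wt -def_k; case=> [] [? ?] [] [? ?]; split; lia.
Qed.

Lemma off_balanced_ex n :
  exists i k j, off_balanced i k j /\ stairs_wt i k j = n.
Proof.
have [k /andP[le_k lt_k]] := floor_sqrt n.+1; rewrite /stairs_wt /off_balanced.
case: k le_k lt_k => [|k] le_k lt_k; first by lia.
(* The form k + 1 = i + j allows remainders up to k + 1 inclusive; larger ones need a middle stair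
   of length k + 2. *)
case: (leqP n.+1 (k.+1 * k.+1 + k.+1)) => [le_n | lt_n].
  have [d def_d] : exists d, d + (n.+1 - k.+1 * k.+1) = k.+1.
    by exists (k.+1 - (n.+1 - k.+1 * k.+1)); lia.
  by exists d, k, (n.+1 - k.+1 * k.+1); split; [left; lia | nia].
have [d def_d] : exists d, d + (n - k.+1 * k.+1 - k.+1) = k.
  by exists (k - (n - k.+1 * k.+1 - k.+1)); lia.
by exists d, k.+2, (n - k.+1 * k.+1 - k.+1); split; [right; lia | nia].
Qed.

Lemma off_balanced_inj i k j i' k' j' :
  off_balanced i k j -> off_balanced i' k' j' ->
  stairs_wt i k j = stairs_wt i' k' j' -> [/\ i = i', k = k' & j = j'].
Proof.
move=> /off_balanced_wt off /off_balanced_wt off' eq_wt.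
pose root i k j := if k.+1 == i + j then k.+1 else k.-1.
have def_root : root i k j = root i' k' j'.
  apply: (@floor_sqrt_uniq (stairs_wt i k j).+1).
    by rewrite /root; case: off => [] [? ?]; case: eqP; nia.
  by rewrite eq_wt /root; case: off' => [] [? ?]; case: eqP; nia.
move: off off' def_root; rewrite -eq_wt /root.
by case=> [] [? ?] [] [? ?]; do 2![case: eqP => ?] => def_root; split; nia.
Qed.

(** * Counting *)

Lemma bt_size k n (Ls : seq (seq nat)) : uniq Ls ->
  (forall la, (la \in Ls) = is_partition_of n la && (wtZ3 la == k)) ->
  bt k n = size Ls.
Proof.
move=> uLs memLs; rewrite /bt cardE.
pose f (s : {bseq n of 'I_n.+1}) := [seq val i | i <- s].
rewrite -(size_map f); apply/perm_size/uniq_perm => //.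
  by rewrite map_inj_uniq ?enum_uniq // => s t /(inj_map val_inj)/val_inj.
move=> la; rewrite memLs; apply/mapP/andP => [[s] | [la_n wt_la]].
  by rewrite mem_enum !inE => /andP[? ?] ->.
have [s s_n def_la] := partition_of_bseq la_n.
by exists s; rewrite // mem_enum !inE in s_n *; rewrite s_n def_la.
Qed.

Lemma bt_eq0 k n : n < k.*2 -> bt k n = 0.
Proof.
move=> lt_n; rewrite (@bt_size k n [::]) // => la; apply/esym/andP.
by case=> /andP[/sumn_wtZ3-> /eqP sum_n] /eqP wt_k; lia.
Qed.

Lemma bt_even n : bt n n.*2 = 1.
Proof.
have [i [k [j [bal wt_n]]]] := balanced_ex n.
have [pla wla] := three_stairsP i k j.
rewrite (@bt_size n n.*2 [:: three_stairs i k j]) // => la.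
rewrite inE; apply/eqP/andP => [-> | [/andP[pla' /eqP sum_la] /eqP wt_la]].
  by rewrite /is_partition_of pla wla sumn_balanced // wt_n !eqxx.
have [|i' [k' [j' [bal' def_la]]]] := even_shapeP pla'; first by rewrite wt_la.
have wt_la' : stairs_wt i k j = stairs_wt i' k' j'.
  by rewrite wt_n -wt_la def_la; case: (three_stairsP i' k' j').
by have [-> -> ->] := balanced_inj bal bal' wt_la'.
Qed.

(** Tells these stairs from widened ones, whose bottom row exceeds the next by more than 3. The tail
    1, 1, 1 is detected by the number of ones instead. *)
Lemma three_stairs_head i k j : let la := three_stairs i k j in
  la != [::] -> head 0 (behead la) < head 0 la <= head 0 (behead la) + 3.
Proof.
rewrite /three_stairs /=.
by case: j k i => [|[|j]] [|[|k]] [|[|i]] //= _; lia.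
Qed.

Lemma count_stairs m r : 1 < m -> count_mem 1 (stairs m r) = 0.
Proof. by move=> m_gt1; elim: r => //= r ->; lia. Qed.

Lemma count_three_stairs i k j : count_mem 1 (three_stairs i k j) <= 1.
Proof.
rewrite !count_cat (@count_stairs (i + k).+3) // (@count_stairs i.+2) //.
by case: i => //= i; elim: i => //= i; lia.
Qed.

Lemma count_widen3 la : count_mem 1 (widen3 la) <= count_mem 1 la.
Proof. by case: la => //= x la; lia. Qed.

(** The three are the off-balanced stairs of weight n + 1 and the two insertions into the balanced
    stairs of weight n, as an insertion adds 1 to the weight and 3 to the size. For n = 0 the latter
    stairs are empty and have no row to widen. *)
Lemma bt_odd n : 0 < n -> bt n.+1 n.+1.*2.+1 = 3.
Proof.
move=> n_gt0.
have [i [k [j [bal wt_n]]]] := balanced_ex n.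
have [i1 [k1 [j1 [off wt_n1]]]] := off_balanced_ex n.+1.
have k_gt0 : 0 < k.
  rewrite lt0n; apply/eqP => k0; move: bal wt_n.
  by rewrite /balanced k0 /stairs_wt; nia.
have nnil i' k' j' : 0 < k' -> three_stairs i' k' j' != [::].
  by case: k' j' => // k' [].
have [pQ wQ] := three_stairsP i k j.
have [pQ1 wQ1] := three_stairsP i1 k1 j1.
have [pW wW sW] := widen3P pQ (nnil i k j k_gt0).
have [pT wT] := three_stairs_111P i k j.
rewrite (@bt_size _ _ [:: three_stairs i1 k1 j1; widen3 (three_stairs i k j);
                          three_stairs i k j ++ [:: 1; 1; 1]]) //.
  have cQ1 := count_three_stairs i1 k1 j1.
  have cW : count_mem 1 (widen3 (three_stairs i k j)) <= 1.
    exact: leq_trans (count_widen3 _) (count_three_stairs i k j).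
  have cT : 2 < count_mem 1 (three_stairs i k j ++ [:: 1; 1; 1]).
    by rewrite count_cat leq_addl.
  rewrite /= !inE negb_or !andbT; apply/andP; split; first (apply/andP; split).
  - apply/eqP => eqQ1; have := three_stairs_head (nnil i k j k_gt0).
    have : three_stairs i1 k1 j1 != [::].
      by rewrite eqQ1; case: (three_stairs i k j) (nnil i k j k_gt0).
    move/three_stairs_head; rewrite eqQ1.
    by case: (three_stairs i k j) (nnil i k j k_gt0) => //= x la _; lia.
  - by apply: contraTneq cT => <-; rewrite -leqNgt (leq_trans cQ1).
  - by apply: contraTneq cT => <-; rewrite -leqNgt (leq_trans cW).
move=> la; rewrite !inE; apply/or3P/andP.
  rewrite /is_partition_of; case=> /eqP->.
  - by rewrite pQ1 wQ1 sumn_off_balanced // wt_n1 !eqxx.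
  - by rewrite pW wW sW wQ sumn_balanced // wt_n; split; apply/eqP; lia.
  - by rewrite pT wT sumn_cat sumn_balanced // wt_n; split=> /=; apply/eqP; lia.
case=> /andP[pla /eqP sum_la] /eqP wt_la.
have [|i' k' j' off' def_la | i' k' j' bal' k'_gt0 def_la
  | i' k' j' bal' def_la] := odd_shapeP pla; first by rewrite wt_la.
- constructor 1; have [_ w'] := three_stairsP i' k' j'.
  have [-> -> ->] : [/\ i1 = i', k1 = k' & j1 = j'].
    by apply: off_balanced_inj; rewrite // wt_n1 -wt_la def_la.
  exact/eqP.
- constructor 2; have [p' w'] := three_stairsP i' k' j'.
  have [_ wW' _] := widen3P p' (nnil i' k' j' k'_gt0).
  have [-> -> ->] : [/\ i = i', k = k' & j = j'].
    by apply: balanced_inj => //; move: wt_la; rewrite def_la wW' w'; lia.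
  exact/eqP.
- constructor 3; have [p' w'] := three_stairs_111P i' k' j'.
  have [-> -> ->] : [/\ i = i', k = k' & j = j'].
    by apply: balanced_inj => //; move: wt_la; rewrite def_la w'; lia.
  exact/eqP.
Qed.

Theorem theorem1p6 :
  (forall n : nat, 2 <= n -> bt n (2 * n) = 1 /\ bt n (2 * n + 1) = 3) /\
  (forall k n : nat, n < 2 * k -> bt k n = 0).
Proof.
split=> [[|n] // n_gt0 | k n]; last by rewrite mul2n; apply: bt_eq0.
by rewrite mul2n addn1; split; [apply: bt_even | apply: bt_odd].
Qed.
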